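(* Let $p$ be a prime, let $n\ge 1$, and let $T$ be an $n$-tangle. Then $\hat\psi(Col^{rd}_p(T))$ is a Lagrangian subspace of the space $\mathbf{Z}_p^{2n-2}$ with the symplectic form $\hat\phi$; in particular, $\dim \hat\psi(Col^{rd}_p(T))=n-1$. Equivalently, $\psi(Col_p(T))$ is a pre-Lagrangian subspace of $\mathbf{Z}_p^{2n-1}$ with the alternating form $\phi$; in particular, $\dim\psi(Col_p(T))=n$.
   Context: An $n$-tangle $T$ is a (classical, unoriented) tangle diagram in a disk: a part of a link diagram lying in a 2-disk with $2n$ endpoints on the boundary circle, labelled $v_1,\dots,v_{2n}$ in cyclic order. Arcs of the diagram run from undercrossing to undercrossing (or to a boundary point; closed components without undercrossings count as one arc). A Fox $p$-coloring of a link or tangle diagram assigns to each arc an element of $\mathbf{Z}_p=\mathbf{Z}/p\mathbf{Z}$ such that at each crossing $a+c=2b$ in $\mathbf{Z}_p$, where $b$ is the color of the overcrossing arc and $a,c$ are the colors of the two undercrossing arcs. The colorings form a $\mathbf{Z}_p$-vector space $Col_p(T)$. Restricting a coloring to the boundary points gives the linear map $\psi=\psi_T:Col_p(T)\to\mathbf{Z}_p^{2n}$, where $\mathbf{Z}_p^{2n}$ has basis $e_1,\dots,e_{2n}$ and $e_i$ corresponds to $v_i$. $\mathbf{Z}_p^{2n-1}\subset\mathbf{Z}_p^{2n}$ denotes the subspace of vectors $\sum a_ie_i$ with $\sum_{i=1}^{2n}(-1)^ia_i=0$; it has basis $f_k=e_k+e_{k+1}$, $1\le k\le 2n-1$. The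 image of $\psi$ lies in this subspace. The alternating form $\phi$ on $\mathbf{Z}_p^{2n-1}$ is given by $\phi(f_i,f_{i+1})=1$, $\phi(f_{i+1},f_i)=-1$, and $\phi(f_i,f_j)=0$ if $|i-j|\neq1$. The vector $e_1+\dots+e_{2n}$ is $\phi$-orthogonal to everything; let $\mathbf{Z}_p^{tr}$ be the line it spans (the monochromatic boundary colorings), and let $\mathbf{Z}_p^{2n-2}=\mathbf{Z}_p^{2n-1}/\mathbf{Z}_p^{tr}$. Then $\phi$ descends to a symplectic (alternating nondegenerate) form $\hat\phi$ on $\mathbf{Z}_p^{2n-2}$. The constant (trivial) colorings form a line in $Col_p(T)$, also denoted $\mathbf{Z}_p^{tr}$; $Col_p^{rd}(T)=Col_p(T)/\mathbf{Z}_p^{tr}$, and $\psi$ descends to $\hat\psi:Col_p^{rd}(T)\to\mathbf{Z}_p^{2n-2}$. A Lagrangian subspace of $(\mathbf{Z}_p^{2n-2},\hat\phi)$ is a maximal subspace on which $\hat\phi$ vanishes identically (these have dimension $n-1$). A pre-Lagrangian subspace of $(\mathbf{Z}_p^{2n-1},\phi)$ is a maximal subspace on which $\phi$ vanishes identically (these have dimension $n$ and contain $\mathbf{Z}_p^{tr}$). *)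

(* Defs.v *)
From HB Require Import structures.
From mathcomp Require Import all_boot all_order all_algebra ring.

Set Implicit Arguments.
Unset Strict Implicit.
Unset Printing Implicit Defensive.

Import GRing.Theory.
Local Open Scope ring_scope.

(** * Quotient of a vector space by a subspace *)

Section QuotientSpace.
Variables (F : fieldType) (V : vectType F) (U : {vspace V}).
Local Open Scope quotient_scope.

Definition quotv : Type := Quotient.quot (pred_of_vspace U : zmodClosed V).

HB.instance Definition _ := GRing.Zmodule.on quotv.
HB.instance Definition _ := EqQuotient.on quotv.

Definition piv (v : V) : quotv := \pi_quotv v.

Definition scaleq (a : F) (x : quotv) : quotv := piv (a *: repr x).

Lemma eq_piv (u v : V) : (piv u == piv v) = (u - v \in U).
Proof. by rewrite Quotient.idealrBE. Qed.

Lemma piv_repr (x : quotv) : piv (repr x) = x.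
Proof. exact: reprK. Qed.

Lemma pivD (u v : V) : piv (u + v) = piv u + piv v.
Proof. by rewrite /piv !piE. Qed.

Lemma scaleq_piv a v : scaleq a (piv v) = piv (a *: v).
Proof.
by apply/eqP; rewrite eq_piv -scalerBr rpredZ // -eq_piv piv_repr.
Qed.

Fact scaleqA a b x : scaleq a (scaleq b x) = scaleq (a * b) x.
Proof. by rewrite -[x]piv_repr !scaleq_piv scalerA. Qed.

Fact scale1q : left_id 1 scaleq.
Proof. by move=> x; rewrite -[x]piv_repr scaleq_piv scale1r. Qed.

Fact scaleqDr : right_distributive scaleq +%R.
Proof.
move=> a x y; rewrite -[x]piv_repr -[y]piv_repr -pivD !scaleq_piv.
by rewrite scalerDr pivD.
Qed.

Fact scaleqDl x : {morph scaleq^~ x : a b / a + b}.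
Proof.
by move=> a b; rewrite -[x]piv_repr !scaleq_piv scalerDl pivD.
Qed.

HB.instance Definition _ := GRing.Zmodule_isLmodule.Build F quotv
  scaleqA scale1q scaleqDr scaleqDl.

Fact piv_is_linear : linear piv.
Proof. by move=> a u v; rewrite pivD -scaleq_piv. Qed.

HB.instance Definition _ := GRing.isLinear.Build F V quotv _ piv piv_is_linear.

Lemma piv_eq0 v : (piv v == 0) = (v \in U).
Proof. by rewrite -(raddf0 piv) eq_piv subr0. Qed.

Import VectorInternalTheory.

Fact quotv_vect_iso : Vector.axiom (dim (subvs_of U^C)) quotv.
Proof.
pose h v := vsproj U^C (v - projv U v).
have hP a u v : h (a *: u + v) = a *: h u + h v.
  rewrite /h -linearP; congr (vsproj _ _).
  by rewrite linearP /= scalerBr opprD addrACA.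
have hU u v : piv u = piv v -> h u = h v.
  move/eqP; rewrite eq_piv => /projv_id Uuv.
  rewrite /h -[u](subrK v); congr (vsproj _ _).
  by rewrite linearD /= Uuv opprD addrACA subrr add0r.
exists (fun x : quotv => v2r (h (repr x))).
  move=> a x y; rewrite -linearP -hP; congr v2r; apply: hU.
  by rewrite linearP /= !piv_repr.
exists (fun r => piv (vsval (r2v r))) => [x | r].
  rewrite v2rK vsprojK ?memv_projC // -[RHS]piv_repr; apply/eqP.
  by rewrite eq_piv addrAC subrr add0r rpredN memv_proj.
apply: (canLR r2vK); rewrite -[RHS]vsvalK; set s := vsval _.
rewrite (hU _ s) ?piv_repr //; apply: subvs_inj.
have Cs : s \in (U^C)%VS by apply: subvsP.
have Cp : projv U s \in (U^C)%VS.
  by rewrite -[X in X \in _](subKr s) rpredB ?memv_projC.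
rewrite !vsprojK ?rpredB //.
suff /eqP-> : projv U s == 0 by rewrite subr0.
by rewrite -memv0 -(capv_compl U) memv_cap memv_proj.
Qed.

HB.instance Definition _ := Lmodule_hasFinDim.Build F quotv quotv_vect_iso.

End QuotientSpace.

(** For U <= W, the subspace W / U of V / U. *)
Definition quotvs (F : fieldType) (V : vectType F) (U W : {vspace V}) :
  {vspace quotv U} := (linfun (piv U) @: W)%VS.

(** * Tangle diagrams *)

(** A tangle diagram is encoded as a combinatorial map on the sphere.  Its
    vertices are the crossings, and one further vertex of degree 2n obtained by
    collapsing the complement of the open disk to a point.

    The half-edges at a crossing are numbered 0, 1, 2, 3 counterclockwise,
    the overcrossing strand being the one through 1 and 3.  The half-edges
    [inr i] are the boundary points v_(i+1), numbered counterclockwise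
    along the boundary circle. *)

Definition half_edge (X : finType) (n : nat) : finType :=
  (X * 'I_4 + 'I_(2 * n))%type.

(** Counterclockwise rotation around a vertex: seen from the collapsed
    complement, the boundary points appear in the reverse order. *)
Definition vertex_rot (X : finType) (n : nat) (d : half_edge X n) :
  half_edge X n :=
  match d with
  | inl (x, i) => inl (x, ordS i)
  | inr i => inr (ord_pred i)
  end.

Arguments vertex_rot : clear implicits.

Section Planarity.
Variables (X : finType) (n : nat) (mate : half_edge X n -> half_edge X n).

Definition face_rot (d : half_edge X n) : half_edge X n := vertex_rot X n (mate d).

Definition map_link : rel (half_edge X n) :=
  [rel d d' | (d' == mate d) || (d' == vertex_rot X n d)].

(** Euler's formula, summed over the connected components.  As each component
    has V - E + F <= 2, equality means that every component is planar. *)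
Definition planar_map : Prop :=
  (fcard mate predT + fcard (vertex_rot X n) predT + fcard face_rot predT =
     #|half_edge X n| + 2 * n_comp map_link predT)%N.

End Planarity.

Record tangle (n : nat) := Tangle {
  crossing : finType;
  mate : half_edge crossing n -> half_edge crossing n;
  ncircles : nat; (* closed components without any crossing *)
  mateK : involutive mate;
  mate_neq : forall d, mate d != d;
  tangle_planar : planar_map mate
}.

Section Arcs.
Variables (n : nat) (T : tangle n).

(** Two half-edges are linked if they form an edge, or if they are the two
    overcrossing half-edges of the same crossing. *)
Definition arc_link : rel (half_edge (crossing T) n) :=
  fun d d' => (d' == mate d) ||
    match d, d' with
    | inl (x, i), inl (y, j) => [&& x == y, odd i & odd j]
    | _, _ => false
    end.

Definition arc_set (d : half_edge (crossing T) n) :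
  {set half_edge (crossing T) n} := [set d' | connect arc_link d d'].

Definition strand_arc : finType :=
  {A : {set half_edge (crossing T) n} | A \in codom arc_set}.

Definition arc : finType := (strand_arc + 'I_(ncircles T))%type.

Definition arc_of (d : half_edge (crossing T) n) : arc :=
  inl (exist _ (arc_set d) (codom_f arc_set d)).

End Arcs.

(** * Fox colorings *)

Section Colorings.
Variables (F : fieldType) (n : nat) (T : tangle n).

Definition precoloring := {ffun arc T -> F^o}.

Definition slot (x : crossing T) (i : 'I_4) : arc T := arc_of (inl (x, i)).

Definition crossing_defect (c : precoloring) : {ffun crossing T -> F^o} :=
  [ffun x => c (slot x (inord 0)) + c (slot x (inord 2))
             - 2%:R * c (slot x (inord 1))].

Fact crossing_defect_is_linear : linear crossing_defect.
Proof.
by move=> a c c'; apply/ffunP=> x; rewrite !ffunE /GRing.scale /=; ring.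
Qed.

HB.instance Definition _ := GRing.isLinear.Build F precoloring
  {ffun crossing T -> F^o} _ crossing_defect crossing_defect_is_linear.

Definition Col : {vspace precoloring} := lker (linfun crossing_defect).

Lemma ColP (c : precoloring) :
  reflect (forall x, c (slot x (inord 0)) + c (slot x (inord 2)) =
                     2%:R * c (slot x (inord 1)))
          (c \in Col).
Proof.
rewrite memv_ker lfunE /=; apply: (iffP eqP) => [/ffunP c0 x | cP].
  by move: (c0 x); rewrite !ffunE => /eqP; rewrite subr_eq0 => /eqP.
by apply/ffunP=> x; rewrite !ffunE cP subrr.
Qed.

Definition boundary (c : precoloring) : 'rV[F]_(2 * n) :=
  \row_i c (arc_of (inr i)).

Fact boundary_is_linear : linear boundary.
Proof. by move=> a c c'; apply/rowP=> i; rewrite !mxE !ffunE. Qed.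

HB.instance Definition _ := GRing.isLinear.Build F precoloring 'rV[F]_(2 * n) _
  boundary boundary_is_linear.

Definition psi : 'Hom(precoloring, 'rV[F]_(2 * n)) := linfun boundary.

Definition trivial_colorings : {vspace precoloring} := <[[ffun=> 1] : precoloring]>%VS.

Lemma trivial_colorings_sub : (trivial_colorings <= Col)%VS.
Proof.
rewrite -memvE; apply/ColP => x; rewrite !ffunE; ring.
Qed.

Definition Col_rd : {vspace quotv trivial_colorings} :=
  quotvs trivial_colorings Col.

End Colorings.

(** * Boundary colorings and the forms phi and hat-phi *)

Section Forms.
Variables (F : fieldType) (n : nat).

(** The basis e_1, ..., e_2n is indexed from 0, hence the exponent. *)
Definition alt_sum (u : 'rV[F]_(2 * n)) : F^o :=
  \sum_(i < 2 * n) (-1) ^+ i.+1 * u 0 i.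

Fact alt_sum_is_linear : linear alt_sum.
Proof.
move=> a u v; rewrite /alt_sum scaler_sumr -big_split /=.
by apply: eq_bigr => i _; rewrite !mxE /GRing.scale /=; ring.
Qed.

HB.instance Definition _ := GRing.isLinear.Build F 'rV[F]_(2 * n) F^o _
  alt_sum alt_sum_is_linear.

(** Z_p^(2n-1) for F = Z_p. *)
Definition Valt : {vspace 'rV[F]_(2 * n)} := lker (linfun alt_sum).

(** [fvec k] is f_(k+1) = e_(k+1) + e_(k+2). *)
Definition fvec (k : nat) : 'rV[F]_(2 * n) :=
  \row_i ((i == k :> nat)%:R + (i == k.+1 :> nat)%:R).

Definition fbasis : (2 * n).-1.-tuple 'rV[F]_(2 * n) :=
  [tuple fvec k | k < (2 * n).-1].

Definition phi_basis (i j : nat) : F := (j == i.+1)%:R - (i == j.+1)%:R.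

(** Only meaningful on [Valt], of which [fbasis] is a basis. *)
Definition phi (u v : 'rV[F]_(2 * n)) : F :=
  \sum_i \sum_j coord fbasis i u * coord fbasis j v * phi_basis i j.

(** Z_p^tr, as a space of boundary colorings. *)
Definition Vtr : {vspace 'rV[F]_(2 * n)} := <[const_mx 1]>%VS.

(** Z_p^(2n-2) *)
Definition Vsymp : {vspace quotv Vtr} := quotvs Vtr Valt.

Definition hat_phi (x y : quotv Vtr) : F := phi (repr x) (repr y).

Lemma fbasis_nth (k : 'I_(2 * n).-1) : fbasis`_k = fvec k.
Proof. by rewrite -tnth_nth tnth_mktuple. Qed.

Lemma fbasis_free : free fbasis.
Proof.
apply/freeP => a a0.
have {}a0 (j : 'I_(2 * n)) : \sum_k a k * ((j == k :> nat)%:R + (j == k.+1 :> nat)%:R) = 0.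
  have /rowP/(_ j) := a0; rewrite summxE mxE => {2}<-.
  by apply: eq_bigr => k _; rewrite fbasis_nth !mxE.
suff aP m (k : 'I_(2 * n).-1) : (k < m)%N -> a k = 0 by move=> k; apply: (aP k.+1).
elim: m k => // m IHm k; rewrite ltnS => lekm.
have ltk : (k < 2 * n)%N by apply: leq_trans (ltn_ord k) (leq_pred _).
have := a0 (Ordinal ltk); rewrite (bigD1 k) //= eqxx big1 ?addr0.
  by rewrite (ltn_eqF (ltnSn k)) addr0 mulr1.
move=> l /negPf kl; rewrite [k == l :> nat]eq_sym val_eqE kl add0r.
case: eqP => [kl1|_]; last by rewrite mulr0.
by rewrite IHm ?mul0r //; apply: leq_trans lekm; rewrite kl1.
Qed.

Lemma fbasis_basis : (0 < n)%N -> basis_of Valt fbasis.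
Proof.
move=> n_gt0; rewrite basisEfree fbasis_free /= size_tuple.
have n2_gt0 : (0 < 2 * n)%N by rewrite muln_gt0.
apply/andP; split.
  apply/span_subvP => w /(nthP 0)[l]; rewrite size_tuple card_ord => ltl <-.
  rewrite (fbasis_nth (Ordinal ltl)); set k := Ordinal ltl.
  have ltk : (k < 2 * n)%N by apply: leq_trans (ltn_ord k) (leq_pred _).
  have ltk1 : (k.+1 < 2 * n)%N by move: (ltn_ord k); rewrite -ltnS (prednK n2_gt0).
  rewrite memv_ker lfunE /= /alt_sum (bigD1 (Ordinal ltk)) //=.
  rewrite (bigD1 (Ordinal ltk1)) /=; last by rewrite -val_eqE /= gtn_eqF.
  rewrite big1 => [|i /andP[/negPf ik /negPf ik1]]; last first.
    by rewrite !mxE -!val_eqE /= in ik ik1 *; rewrite ik ik1 addr0 mulr0.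
  rewrite !mxE /= !eqxx (ltn_eqF (ltnSn _)) (gtn_eqF (ltnSn _)) [_ ^+ k.+2]exprS.
  by apply/eqP; ring.
have := limg_ker_dim (linfun alt_sum) fullv; rewrite capfv dimvf /dim /= mul1n.
set d := \dim (_ @: _) => dimE.
have aux a b m : (a + b = m -> 0 < b -> a <= m.-1)%N.
  by case: b => [|b] // <- _; rewrite addnS leq_addr.
suff d_gt0 : (0 < d)%N by rewrite card_ord; apply: aux dimE d_gt0.
rewrite lt0n dimv_eq0; apply: contraTneq (oner_neq0 F) => im0.
have: linfun alt_sum (delta_mx 0 (Ordinal n2_gt0)) \in (linfun alt_sum @: fullv)%VS.
  by rewrite memv_img ?memvf.
rewrite im0 memv0 lfunE /= /alt_sum (bigD1 (Ordinal n2_gt0)) //= big1 => [|i /negPf i0].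
  by rewrite mxE !eqxx mulr1 addr0 expr1 oppr_eq0 => /eqP->; rewrite eqxx.
by rewrite mxE i0 andbF mulr0.
Qed.

Lemma phi_fvec (i j : 'I_(2 * n).-1) : phi (fvec i) (fvec j) = phi_basis i j.
Proof.
have coordE (k l : 'I_(2 * n).-1) : coord fbasis l (fvec k) = (k == l)%:R.
  by rewrite -fbasis_nth coord_free ?fbasis_free.
rewrite /phi (bigD1 i) //= (bigD1 j) //= !coordE !eqxx !mul1r.
rewrite !big1 ?addr0 // => [k | k] /negPf; rewrite eq_sym => ne.
  by apply: big1 => l _; rewrite coordE ne !mul0r.
by rewrite coordE ne mulr0 mul0r.
Qed.


Lemma phiDl u u' v : phi (u + u') v = phi u v + phi u' v.
Proof.
rewrite /phi -big_split; apply: eq_bigr => i _; rewrite -big_split.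
by apply: eq_bigr => j _; rewrite linearD /= !mulrDl.
Qed.

Lemma phiZl a u v : phi (a *: u) v = a * phi u v.
Proof.
rewrite /phi mulr_sumr; apply: eq_bigr => i _; rewrite mulr_sumr.
by apply: eq_bigr => j _; rewrite linearZ /= !mulrA.
Qed.

Lemma phiC u v : phi v u = - phi u v.
Proof.
rewrite /phi exchange_big -sumrN; apply: eq_bigr => i _; rewrite -sumrN.
by apply: eq_bigr => j _; rewrite /phi_basis; ring.
Qed.

Lemma sum_even_eq m :
  \sum_(k < (2 * n).-1 | ~~ odd k) ((m == k :> nat)%:R : F) =
  (~~ odd m && (m < (2 * n).-1)%N)%:R.
Proof.
case: (ltnP m (2 * n).-1) => [ltm | lem]; last first.
  rewrite andbF big1 // => k _; case: eqP => // mk.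
  by have := ltn_ord k; rewrite -mk ltnNge lem.
rewrite andbT; case: (boolP (odd m)) => om /=.
  by rewrite big1 // => k ok; case: eqP => // mk; rewrite -mk om in ok.
rewrite (bigD1 (Ordinal ltm)) //= eqxx big1 ?addr0 // => k /andP[_].
by rewrite -val_eqE eq_sym /= => /negPf->.
Qed.

Lemma const_mx_fvec :
  const_mx 1 = \sum_(k < (2 * n).-1 | ~~ odd k) fvec k.
Proof.
apply/rowP => j; rewrite summxE mxE; under eq_bigr do rewrite mxE.
rewrite big_split /= sum_even_eq; case: j => -[|j] ltj /=.
  rewrite big1 // addr0; suff -> : (0 < (2 * n).-1)%N by [].
  by case: (n) ltj => // m _; rewrite mulnS.
under eq_bigr do rewrite eqSS.
have ltj' : (j < (2 * n).-1)%N by move: ltj; case: (2 * n)%N.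
rewrite sum_even_eq ltj' andbT /= negbK; case: (boolP (odd j)) => oj.
  suff -> : (j.+1 < (2 * n).-1)%N by rewrite addr0.
  rewrite ltn_neqAle ltj' andbT; apply: contraTneq oj => jn.
  have := odd_double n; rewrite -mul2n; case: (2 * n)%N jn ltj => //= m <- _ /=.
  by case: (odd j).
by rewrite add0r.
Qed.

Lemma phi_const v : (0 < n)%N -> v \in Valt -> phi (const_mx 1) v = 0.
Proof.
move=> n_gt0 /(coord_basis (fbasis_basis n_gt0)) ->.
have phi0 u : phi 0 u = 0 by rewrite -[0](scale0r 0) phiZl mul0r.
have n2_gt0 : (0 < 2 * n)%N by rewrite muln_gt0.
rewrite phiC; apply/eqP; rewrite oppr_eq0; apply/eqP.
elim/big_ind: _ => // [u w pu pw | k _]; first by rewrite phiDl pu pw addr0.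
rewrite phiZl fbasis_nth phiC const_mx_fvec.
rewrite (big_morph (phi^~ _) (id1 := 0) (op1 := +%R)) => [|u w|]; rewrite ?phiDl //.
under eq_bigr do rewrite phi_fvec /phi_basis [_ == k.+1]eq_sym.
rewrite sumrB sum_even_eq; case: k => -[|k] ltk /=; first by rewrite big1 ?subrr ?oppr0 ?mulr0.
under eq_bigr do rewrite eqSS.
rewrite sum_even_eq /= negbK (ltnW ltk) andbT.
case: (boolP (odd k)) => ok /=; first by rewrite subrr oppr0 mulr0.
suff -> : (k.+2 < (2 * n).-1)%N by rewrite subrr oppr0 mulr0.
rewrite ltn_neqAle ltk andbT; apply: contraNneq ok => kn.
have := odd_double n; rewrite -mul2n; case: (2 * n)%N kn n2_gt0 => //= m <- _ /=.
by case: (odd k).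
Qed.

(** phi descends to Z_p^(2n-2). *)
Lemma hat_phi_piv u v : (0 < n)%N -> u \in Valt -> v \in Valt ->
  hat_phi (piv Vtr u) (piv Vtr v) = phi u v.
Proof.
move=> n_gt0 Vu Vv.
have Vtr_Valt w : w \in Vtr -> w \in Valt.
  case/vlineP=> a ->; apply: rpredZ; rewrite const_mx_fvec.
  apply: rpred_sum => k _; rewrite -fbasis_nth.
  by apply: (basis_mem (fbasis_basis n_gt0)); rewrite mem_nth ?size_tuple ?card_ord ?ltn_ord.
have phi_tr w z : w \in Vtr -> z \in Valt -> phi w z = 0.
  by case/vlineP=> a -> Vz; rewrite phiZl phi_const ?mulr0.
have repr_tr w : repr (piv Vtr w) - w \in Vtr by rewrite -eq_piv piv_repr.
have Vrepr w : w \in Valt -> repr (piv Vtr w) \in Valt.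
  by move=> Vw; rewrite -(subrK w (repr _)) rpredD // Vtr_Valt.
rewrite /hat_phi -[repr _ in X in phi X](subrK u) phiDl phi_tr ?Vrepr // add0r.
by rewrite phiC -(subrK v (repr _)) phiDl phi_tr // add0r -phiC.
Qed.

End Forms.

Section HatPsi.
Variables (F : fieldType) (n : nat) (T : tangle n).

Definition hat_psi_fun (x : quotv (trivial_colorings F T)) : quotv (Vtr F n) :=
  piv (Vtr F n) (psi F T (repr x)).

Lemma hat_psi_fun_piv c :
  hat_psi_fun (piv (trivial_colorings F T) c) = piv (Vtr F n) (psi F T c).
Proof.
apply/eqP; rewrite eq_piv -linearB /=.
have: repr (piv (trivial_colorings F T) c) - c \in trivial_colorings F T.
  by rewrite -eq_piv piv_repr.
case/vlineP=> a ->; rewrite linearZ rpredZ //= lfunE /=.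
suff -> : boundary ([ffun=> 1] : precoloring F T) = const_mx 1.
  exact: memv_line.
by apply/rowP=> i; rewrite !mxE ffunE.
Qed.

Fact hat_psi_fun_is_linear : linear hat_psi_fun.
Proof.
move=> a x y; rewrite -[x]piv_repr -[y]piv_repr -linearP !hat_psi_fun_piv.
by rewrite !linearP.
Qed.

HB.instance Definition _ := GRing.isLinear.Build F
  (quotv (trivial_colorings F T)) (quotv (Vtr F n)) _ hat_psi_fun hat_psi_fun_is_linear.

Definition hat_psi : 'Hom(quotv (trivial_colorings F T), quotv (Vtr F n)) :=
  linfun hat_psi_fun.

End HatPsi.

(** * Maximal isotropic subspaces *)

Section Isotropic.
Variables (F : fieldType) (V : vectType F) (form : V -> V -> F).

Definition isotropic (W : {vspace V}) : Prop :=
  {in W &, forall u v, form u v = 0}.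

Definition maximal_isotropic (E W : {vspace V}) : Prop :=
  [/\ (W <= E)%VS, isotropic W &
      forall W' : {vspace V},
        (W' <= E)%VS -> isotropic W' -> (W <= W')%VS -> W' = W].

End Isotropic.

Definition lagrangian (F : fieldType) (n : nat) (W : {vspace quotv (Vtr F n)}) :=
  maximal_isotropic (@hat_phi F n) (Vsymp F n) W.

Definition pre_lagrangian (F : fieldType) (n : nat) (W : {vspace 'rV[F]_(2 * n)}) :=
  maximal_isotropic (@phi F n) (Valt F n) W.

(* Main.v *)
From HB Require Import structures.
Require Import Defs.
From mathcomp Require Import all_boot all_order all_algebra ring zify.

(** Write W for the space of boundary colorings that extend to the tangle.  The
    whole theorem follows from the statement that W is its own orthogonal for
    phi inside the space [Valt]: a subspace equal to its own orthogonal is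
    maximal isotropic, its dimension is forced, and since W contains the
    constant vector everything passes to the quotient.

    The proof goes through the faces of the diagram.  Let t be a function on
    half-edges which is a flow: opposite on the two ends of each edge, and of
    sum zero around each vertex.  In a planar map every flow is the jump
    t d = y (rot d) - y d of a function y constant on the faces, rot being the
    rotation around the vertices; this is the vanishing of H^1, and counting
    dimensions it is exactly Euler's formula ([planar_exact]).  Over F_2 the
    constant function 1 is a flow, so the faces have a checkerboard coloring.
    Multiplying a Fox coloring by checkerboard signs makes it a flow, so that
    every Fox coloring has face labels whose sums across the edges are the colors
    ([fox_faces]).

    If u is in [Valt] and v i is the sum of the labels y on both sides of the
    boundary point i, then phi u v is the sum of the products of u i with the
    jump of y at i ([phi_corner]).  So phi is the contribution of the boundary
    vertex to the sum of color times jump over all half-edges.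

    - Isotropy ([boundary_isotropy]).  Summed over all half-edges, color times
      jump vanishes because the two ends of an edge cancel; at each crossing the
      contribution vanishes by the Fox relations; hence it also vanishes at the
      boundary.

    - Coisotropy ([boundary_coisotropy]).  A linear form on boundary values that
      vanishes on all colorings is a combination of edge relations and crossing
      relations.  The edge part of such a combination is itself a flow, and the
      face labels it comes from are those of a Fox coloring.  The form is thus
      the pairing under phi with the boundary of that coloring.

    Finally, labels of the boundary corners whose sums lie in W are the same as
    labels whose jumps lie in the standard orthogonal of W; comparing dimensions
    gives dim W = 2n - dim W ([dim_self_dual]). *)

Set Implicit Arguments.
Unset Strict Implicit.
Unset Printing Implicit Defensive.

Import GRing.Theory.
Local Open Scope ring_scope.

(** * Orthogonal complements for the standard pairing *)

Section Orthogonal.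
Variables (F : fieldType) (D : finType).
Implicit Types (u v : {ffun D -> F^o}) (U W : {vspace {ffun D -> F^o}}).

Definition dot u v : F := \sum_d u d * v d.

Definition dot_basis U v : 'rV[F]_(\dim U) := \row_i dot (vbasis U)`_i v.

Fact dot_basis_is_linear U : linear (dot_basis U).
Proof.
move=> a v w; apply/rowP=> i; rewrite !mxE /dot mulr_sumr -big_split /=.
by apply: eq_bigr => d _; rewrite !ffunE /GRing.scale /=; ring.
Qed.

HB.instance Definition _ U := GRing.isLinear.Build F {ffun D -> F^o}
  'rV[F]_(\dim U) _ (dot_basis U) (dot_basis_is_linear U).

Definition perp U : {vspace {ffun D -> F^o}} := lker (linfun (dot_basis U)).

Lemma dotC u v : dot u v = dot v u.
Proof. by apply: eq_bigr => d _; rewrite mulrC. Qed.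

Lemma perpP U v :
  reflect (forall u, u \in U -> dot u v = 0) (v \in perp U).
Proof.
rewrite memv_ker lfunE /=; apply: (iffP eqP) => [/rowP v0 u | v0]; last first.
  by apply/rowP=> i; rewrite !mxE v0 // vbasis_mem ?mem_nth ?size_tuple.
move=> /coord_vbasis ->; rewrite /dot.
under eq_bigr do rewrite sum_ffunE mulr_suml.
rewrite exchange_big big1 //= => i _.
under eq_bigr do rewrite !ffunE -mulrA.
rewrite -mulr_sumr; move: (v0 i); rewrite !mxE /dot => ->; exact: mulr0.
Qed.

Lemma dim_ffun : \dim {:{ffun D -> F^o}} = #|D|.
Proof. by rewrite dimvf /dim /= muln1. Qed.

(** Pairing with a basis of U is onto, because the matrix of a free family has
    a right inverse. *)
Lemma dim_perp U : (\dim (perp U) + \dim U = #|D|)%N.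
Proof.
pose M := \matrix_(i < \dim U, j < #|D|) (vbasis U)`_i (enum_val j).
have /row_freeP[N MN1] : row_free M.
  rewrite -kermx_eq0; apply/eqP/row_matrixP=> k.
  have: row k (kermx M) *m M = 0 by rewrite -row_mul mulmx_ker row0.
  rewrite row0; move: (row k _) => r rM0; apply/rowP=> i; rewrite [RHS]mxE.
  have /freeP/(_ (fun j => r 0 j)) := basis_free (vbasisP U); apply.
  apply/ffunP=> d; rewrite sum_ffunE ffunE.
  have /rowP/(_ (enum_rank d)) := rM0; rewrite !mxE => {2}<-.
  by apply: eq_bigr => j _; rewrite !mxE enum_rankK ffunE.
have imT : (linfun (dot_basis U) @: fullv)%VS = fullv.
  apply/eqP; rewrite eqEsubv subvf; apply/subvP=> r _; apply/memv_imgP.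
  exists [ffun d => (r *m N^T) 0 (enum_rank d)]; first exact: memvf.
  have rE : r = r *m N^T *m M^T by rewrite -mulmxA -trmx_mul MN1 trmx1 mulmx1.
  (* Forgetting how q was obtained keeps mxE from unfolding its entries. *)
  rewrite lfunE /= [LHS]rE {rE}; move: (r *m _) => q.
  apply/rowP=> i; rewrite !mxE /dot (reindex _ (onW_bij _ (enum_val_bij D))) /=.
  by apply: eq_bigr => j _; rewrite !mxE ffunE enum_valK mulrC.
rewrite -dim_ffun -(limg_ker_dim (linfun (dot_basis U)) fullv) capfv imT.
by rewrite dimvf /dim /= mul1n.
Qed.

Lemma perpK U : perp (perp U) = U.
Proof.
apply/esym/eqP; rewrite eqEdim; apply/andP; split.
  apply/subvP=> u Uu; apply/perpP=> v /perpP v0.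
  by rewrite dotC v0.
by rewrite -(leq_add2r (\dim (perp U))) dim_perp addnC dim_perp.
Qed.

Lemma perpD U W : perp (U + W) = (perp U :&: perp W)%VS.
Proof.
apply/vspaceP=> v; rewrite memv_cap; apply/perpP/andP => [v0 | [Uv Wv] z].
  by split; apply/perpP=> u Pu; apply: v0; apply: subvP Pu; rewrite (addvSl, addvSr).
case/memv_addP=> u Uu [w Ww ->]; rewrite /dot.
under eq_bigr do rewrite !ffunE mulrDl.
rewrite big_split /= -/(dot u v) -/(dot w v).
by rewrite (perpP _ _ Uv) // (perpP _ _ Wv) // addr0.
Qed.

Lemma perp_cap U W : perp (U :&: W) = (perp U + perp W)%VS.
Proof. by rewrite -[LHS]perpK -[RHS]perpK perpD !perpK. Qed.

End Orthogonal.

(** * Functions constant on connected components *)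

Section Invariants.
Variables (F : fieldType) (D : finType) (e : rel D).

(** The map whose kernel is [invariants]; it only serves to make the latter a
    subspace. *)
Definition variation (x : {ffun D -> F^o}) : {ffun D * D -> F^o} :=
  [ffun p => if e p.1 p.2 then x p.1 - x p.2 else 0].

Fact variation_is_linear : linear variation.
Proof.
move=> a x y; apply/ffunP=> p; rewrite !ffunE /GRing.scale /=.
by case: ifP => _; ring.
Qed.

HB.instance Definition _ := GRing.isLinear.Build F {ffun D -> F^o}
  {ffun D * D -> F^o} _ variation variation_is_linear.

Definition invariants : {vspace {ffun D -> F^o}} := lker (linfun variation).

Implicit Type x : {ffun D -> F^o}.

Lemma invariantsP x :
  reflect (forall d d', e d d' -> x d = x d') (x \in invariants).
Proof.
rewrite memv_ker lfunE /=; apply: (iffP eqP) => [/ffunP x0 d d' edd' | x0].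
  by move: (x0 (d, d')); rewrite !ffunE /= edd' => /eqP; rewrite subr_eq0 => /eqP.
by apply/ffunP=> p; rewrite !ffunE; case: ifP => // /x0 ->; rewrite subrr.
Qed.

Lemma invariants_connect x d d' :
  x \in invariants -> connect e d d' -> x d = x d'.
Proof.
move/invariantsP=> x0 /connectP[p]; elim: p d => [|d1 p IHp] d /=; first by move=> _ ->.
by case/andP=> /x0 -> /IHp.
Qed.

Definition root_values (x : {ffun D -> F^o}) :
  {ffun {d | roots e d} -> F^o} := [ffun r => x (val r)].

Fact root_values_is_linear : linear root_values.
Proof. by move=> a x y; apply/ffunP=> r; rewrite !ffunE. Qed.

HB.instance Definition _ := GRing.isLinear.Build F {ffun D -> F^o}
  {ffun {d | roots e d} -> F^o} _ root_values root_values_is_linear.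

(** An invariant function is determined by its values at one representative of
    each component, and these values are arbitrary. *)
Lemma dim_invariants : connect_sym e -> \dim invariants = n_comp e predT.
Proof.
move=> sym_e.
pose rt d : {d | roots e d} := Sub (fingraph.root e d) (roots_root sym_e d).
have -> : n_comp e predT = #|{: {d | roots e d}}|.
  by rewrite card_sig; apply: eq_card => d; rewrite !inE andbT.
rewrite -(dim_ffun F) -(@limg_dim_eq _ _ _ (linfun root_values)); last first.
  apply/eqP; rewrite -subv0; apply/subvP=> x; rewrite memv_cap memv_ker lfunE /=.
  case/andP=> Ix /eqP/ffunP x0; rewrite memv0; apply/eqP/ffunP=> d.
  rewrite (invariants_connect Ix (connect_root e d)).
  by have := x0 (rt d); rewrite !ffunE.
congr (\dim _); apply/eqP; rewrite eqEsubv subvf; apply/subvP=> y _.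
apply/memv_imgP; exists [ffun d => y (rt d)].
  apply/invariantsP=> d d' /connect1/(fingraph.rootP sym_e) edd'; rewrite !ffunE.
  by congr (y _); apply: val_inj.
rewrite lfunE; apply/ffunP=> r; rewrite !ffunE; congr (y _).
by apply: val_inj; apply/esym/eqP; exact: (valP r).
Qed.

End Invariants.

Arguments perpP {F D U v}.
Arguments invariantsP {F D e x}.

(** * Flows on planar maps *)

Section Exactness.
Variables (F : fieldType) (D : finType) (alpha sigma : D -> D).
Hypotheses (alphaK : involutive alpha) (sigma_inj : injective sigma).

Local Notation face := (fun d => sigma (alpha d)).
Local Notation link := [rel d d' | (d' == alpha d) || (d' == sigma d)].

Let link_sym : connect_sym link.
Proof.
have eq_link : link =2 relU (frel alpha) (frel sigma).
  by move=> d d'; rewrite /= eq_sym [d' == sigma d]eq_sym.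
move=> d d'; rewrite !(eq_connect eq_link); apply: relU_sym.
  exact/fconnect_sym/inv_inj.
exact: fconnect_sym.
Qed.

Let face_inj : injective face.
Proof. by move=> d d' /sigma_inj/(inv_inj alphaK). Qed.

(** With sigma the counterclockwise rotation and half-edges oriented away from
    their vertex, the face of d lies on the right of d and that of [sigma d] on
    its left: for a face labelling x, this is the jump of x across d. *)
Definition coboundary (x : {ffun D -> F^o}) : {ffun D -> F^o} :=
  [ffun d => x (sigma d) - x d].

Fact coboundary_is_linear : linear coboundary.
Proof. by move=> a x y; apply/ffunP=> d; rewrite !ffunE /GRing.scale /=; ring. Qed.

HB.instance Definition _ := GRing.isLinear.Build F {ffun D -> F^o}
  {ffun D -> F^o} _ coboundary coboundary_is_linear.

Definition face_labels := invariants F (frel face).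

Implicit Type x : {ffun D -> F^o}.

Lemma face_labelsP x : reflect (forall d, x (face d) = x d) (x \in face_labels).
Proof.
apply: (iffP invariantsP) => [x0 d | x0 d d' /eqP <-]; last by rewrite x0.
by apply/esym/x0/eqP.
Qed.

Lemma face_labels_mate x d : x \in face_labels -> x (alpha d) = x (sigma d).
Proof. by move/face_labelsP/(_ (alpha d)); rewrite alphaK. Qed.

Lemma face_coboundary :
  (linfun coboundary @: face_labels <=
     perp (invariants F (frel alpha) + invariants F (frel sigma)))%VS.
Proof.
apply/subvP=> _ /memv_imgP[x Fx ->]; rewrite lfunE /= perpD memv_cap.
apply/andP; split; apply/perpP=> u /invariantsP Iu; rewrite /dot.
  under eq_bigr do rewrite ffunE -(face_labels_mate _ Fx) mulrBr.
  rewrite sumrB (reindex_inj (inv_inj alphaK)) /=.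
  apply/eqP; rewrite subr_eq0; apply/eqP/eq_bigr => d _.
  by rewrite alphaK -(Iu d) // /= eqxx.
under eq_bigr do rewrite ffunE mulrBr.
rewrite sumrB [X in _ - X](reindex_inj sigma_inj) /=.
apply/eqP; rewrite subr_eq0; apply/eqP/eq_bigr => d _.
by rewrite -(Iu d) // /= eqxx.
Qed.

(** The functions orthogonal to both kinds of invariants are the flows.  They
    have dimension |D| - E - V + C, and jumps of face labellings have dimension
    F - C, a labelling without jumps being constant on each component.  Euler's
    formula says that these numbers agree. *)
Lemma planar_exact (t : {ffun D -> F^o}) :
    (fcard alpha predT + fcard sigma predT + fcard face predT =
       #|D| + 2 * n_comp link predT)%N ->
    t \in perp (invariants F (frel alpha)) ->
    t \in perp (invariants F (frel sigma)) ->
  exists2 x, x \in face_labels & forall d, t d = x (sigma d) - x d.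
Proof.
move=> euler At St.
have Ilink : (invariants F (frel alpha) :&: invariants F (frel sigma))%VS =
    invariants F link.
  apply/vspaceP=> x; rewrite memv_cap.
  apply/andP/invariantsP => [[/invariantsP Ax /invariantsP Sx] d d' | Lx].
    by case/orP=> /eqP->; [apply: Ax | apply: Sx] => /=.
  by split; apply/invariantsP=> d _ /eqP <-; apply: Lx; rewrite /= eqxx ?orbT.
have Fker : (face_labels :&: lker (linfun coboundary))%VS = invariants F link.
  rewrite -Ilink; apply/vspaceP=> x.
  rewrite !memv_cap [X in _ && X = _]memv_ker lfunE /=.
  apply/andP/andP => [[Fx /eqP cx0] | [/invariantsP Ax /invariantsP Sx]].
    have x0 d : x (sigma d) = x d.
      by apply/eqP; rewrite -subr_eq0; have /ffunP/(_ d) := cx0; rewrite !ffunE => ->.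
    by split; apply/invariantsP=> d _ /eqP <-; rewrite ?(face_labels_mate _ Fx) x0.
  have Se d : x (sigma d) = x d by rewrite -(Sx d) //= eqxx.
  have Ae d : x (alpha d) = x d by rewrite -(Ax d) //= eqxx.
  split; first by apply/face_labelsP=> d; rewrite Se Ae.
  by apply/eqP/ffunP=> d; rewrite !ffunE Se subrr.
have dimA := dim_invariants F (fconnect_sym (inv_inj alphaK)).
have dimS := dim_invariants F (fconnect_sym sigma_inj).
have dimF := dim_invariants F (fconnect_sym face_inj).
have dimL := dim_invariants F link_sym.
have := dimv_sum_cap (invariants F (frel alpha)) (invariants F (frel sigma)).
have := dim_perp (invariants F (frel alpha) + invariants F (frel sigma))%VS.
have := limg_ker_dim (linfun coboundary) face_labels.
rewrite Ilink Fker dimA dimS dimL dimF => d1 d2 d3.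
have count a s f m l q p i : (a + s + f = m + 2 * l -> l + i = f ->
    p + q = m -> q + l = a + s -> p <= i)%N by lia.
have: t \in (linfun coboundary @: face_labels)%VS.
  have /eqP-> : (linfun coboundary @: face_labels)%VS ==
      perp (invariants F (frel alpha) + invariants F (frel sigma)).
    by rewrite eqEdim face_coboundary; apply: count euler d1 d2 d3.
  by rewrite perpD memv_cap At.
by case/memv_imgP=> x Fx ->; exists x => // d; rewrite lfunE ffunE.
Qed.

End Exactness.

Arguments face_labelsP {F D alpha sigma x}.

(** The two ends of each edge must be told apart, because in characteristic 2
    reindexing by alpha only shows that the sum is its own opposite. *)
Lemma antisym_perp (F : fieldType) (D : finType) (alpha : D -> D)
    (t : {ffun D -> F^o}) :
    involutive alpha -> (forall d, alpha d != d) ->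
    (forall d, t (alpha d) = - t d) ->
  t \in perp (invariants F (frel alpha)).
Proof.
move=> alphaK alphaN tN; apply/perpP=> u /invariantsP Iu.
pose first d := (enum_rank d < enum_rank (alpha d))%N.
have firstN d : first (alpha d) = ~~ first d.
  rewrite /first alphaK -leqNgt ltn_neqAle.
  by rewrite (inj_eq val_inj) (inj_eq enum_rank_inj) alphaN.
have uA d : u (alpha d) = u d by rewrite -(Iu d) //= eqxx.
rewrite /dot (bigID first) /= (reindex_inj (inv_inj alphaK)) /=.
under eq_bigl do rewrite firstN.
rewrite -big_split big1 //= => d _; rewrite uA tN.
by ring.
Qed.

(** * Half-edges of a tangle diagram *)

Lemma ord_pred_const (A : Type) (m : nat) (f : 'I_m -> A) :
  (forall i, f (ord_pred i) = f i) -> forall i j, f i = f j.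
Proof.
move=> fP; suff f0 (i j : 'I_m) : val j = 0%N -> f i = f j.
  move=> i j; have m_gt0 : (0 < m)%N by apply: leq_trans (ltn_ord i).
  by rewrite (f0 i (Ordinal m_gt0)) // (f0 j (Ordinal m_gt0)).
move=> j0; case: i; elim=> [|k IHk] ltk; first by congr f; apply: val_inj.
rewrite -(IHk (ltnW ltk)) -fP; congr f; apply: val_inj => /=.
by rewrite modnDr modn_small // ltnW.
Qed.

Section Tangle.
Variables (F : fieldType) (n : nat) (T : tangle n).

Local Notation D := (half_edge (crossing T) n).
Local Notation mate := (@mate n T).
Local Notation rot := (vertex_rot (crossing T) n).
Local Notation faces := (face_labels F mate rot).

Definition at_crossing (x : crossing T) (k : nat) : D := inl (x, inord k).

Definition at_boundary (i : 'I_(2 * n)) : D := inr i.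

Lemma rot_inj : injective rot.
Proof.
move=> [[x i]|i] [[y j]|j] //= [].
  by move=> -> ij; congr (inl (_, _)); apply: ordS_inj; apply: val_inj.
by move=> ij; congr inr; apply: ord_pred_inj; apply: val_inj.
Qed.

Lemma rot_crossing x :
  (rot (at_crossing x 0) = at_crossing x 1) *
  (rot (at_crossing x 1) = at_crossing x 2) *
  (rot (at_crossing x 2) = at_crossing x 3) *
  (rot (at_crossing x 3) = at_crossing x 0).
Proof.
by do !split; congr (inl (x, _)); apply: val_inj; rewrite /= !inordK.
Qed.

Lemma sum_half_edges (V : nmodType) (f : D -> V) :
  \sum_d f d = \sum_x (f (at_crossing x 0) + f (at_crossing x 1) +
                       f (at_crossing x 2) + f (at_crossing x 3)) +
               \sum_i f (at_boundary i).
Proof.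
rewrite big_sumType /=; congr (_ + _).
rewrite (eq_bigr (fun p => f (inl (p.1, p.2)))) => [|[] //].
rewrite -(pair_bigA _ (fun x i => f (inl (x, i)))) /=.
apply: eq_bigr => x _; rewrite !big_ord_recl big_ord0 addr0 !addrA.
by do !congr (_ + _); congr (f (inl (x, _))); apply: val_inj; rewrite /= inordK.
Qed.

(** Kirchhoff's law at the boundary vertex is a consequence of the law at the
    crossings, since an antisymmetric function has total sum zero. *)
Lemma tangle_flow (t : {ffun D -> F^o}) :
    t \in perp (invariants F (frel mate)) ->
    (forall x, t (at_crossing x 0) + t (at_crossing x 1) +
               t (at_crossing x 2) + t (at_crossing x 3) = 0) ->
  exists2 y, y \in faces & forall d, t d = y (rot d) - y d.
Proof.
move=> Mt Xt; apply: planar_exact => //; first exact: mateK.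
- exact: rot_inj.
- exact: (tangle_planar T).
apply/perpP=> u /invariantsP Iu.
have Ru d : u (rot d) = u d by rewrite -(Iu d) //= eqxx.
have R1 x : u (at_crossing x 1) = u (at_crossing x 0).
  by rewrite -[RHS]Ru rot_crossing.
have R2 x : u (at_crossing x 2) = u (at_crossing x 0).
  by rewrite -R1 -[RHS]Ru rot_crossing.
have R3 x : u (at_crossing x 3) = u (at_crossing x 0).
  by rewrite -R2 -[RHS]Ru rot_crossing.
have Rb i j : u (at_boundary i) = u (at_boundary j).
  apply: (ord_pred_const (f := u \o at_boundary)) => {i j} i.
  exact: (Ru (at_boundary i)).
have Xu x :
    u (at_crossing x 0) * t (at_crossing x 0) +
    u (at_crossing x 1) * t (at_crossing x 1) +
    u (at_crossing x 2) * t (at_crossing x 2) +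
    u (at_crossing x 3) * t (at_crossing x 3) = 0.
  by rewrite R1 R2 R3 -!mulrDr Xt mulr0.
have tot : \sum_i t (at_boundary i) = 0.
  have one_inv : [ffun=> 1] \in invariants F (frel mate).
    by apply/invariantsP=> d d' _; rewrite !ffunE.
  have := perpP Mt _ one_inv; rewrite /dot.
  under eq_bigr do rewrite ffunE mul1r.
  by rewrite sum_half_edges big1 ?add0r.
rewrite /dot sum_half_edges big1 ?add0r //.
case: (pickP 'I_(2 * n)) => [i0 _ | no_i]; last by rewrite big1 // => i; have := no_i i.
under eq_bigr do rewrite (Rb _ i0).
by rewrite -mulr_sumr tot mulr0.
Qed.

End Tangle.

(** All vertices of the map have even degree, so that the constant 1 is a flow
    with coefficients in F_2; its face labels are the two colors. *)
Lemma checkerboard (n : nat) (T : tangle n) :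
  exists b : half_edge (crossing T) n -> bool,
    (forall d, b (mate d) = ~~ b d) /\
    (forall d, b (vertex_rot (crossing T) n d) = ~~ b d).
Proof.
pose t : {ffun half_edge (crossing T) n -> ('F_2)^o} := [ffun=> 1].
have neg1 : (1 : 'F_2) = -1 by apply: val_inj.
have [||y Fy dy] := @tangle_flow 'F_2 n T t.
- apply: antisym_perp (@mateK n T) (@mate_neq n T) _ => d.
  by rewrite !ffunE [LHS]neg1.
- by move=> x; rewrite !ffunE; apply: val_inj.
have yR d : y (vertex_rot (crossing T) n d) = y d + 1.
  by have := dy d; rewrite ffunE => ->; rewrite addrC subrK.
have F2 (a : 'F_2) : (a + 1 == 0) = ~~ (a == 0) by case: a => -[|[|]].
exists (fun d => y d == 0); split=> d; last by rewrite yR F2.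
by rewrite (face_labels_mate (@mateK n T) _ Fy) yR F2.
Qed.

(** * Fox colorings as labellings of half-edges and of faces *)

Section Fox.
Variables (F : fieldType) (n : nat) (T : tangle n).

Local Notation D := (half_edge (crossing T) n).
Local Notation mate := (@mate n T).
Local Notation rot := (vertex_rot (crossing T) n).
Local Notation faces := (face_labels F mate rot).
Local Notation cr := (@at_crossing n T).
Local Notation bd := (@at_boundary n T).

Definition fox_labelling (C : D -> F) : Prop :=
  [/\ forall d, C (mate d) = C d,
      forall x, C (cr x 1) = C (cr x 3)
    & forall x, C (cr x 0) + C (cr x 2) = 2%:R * C (cr x 1)].

Lemma arc_connect_sym : connect_sym (@arc_link n T).
Proof.
apply: sym_connect_sym => d d'; rewrite /arc_link; congr (_ || _).
  by rewrite eq_sym (can2_eq (@mateK _ T) (@mateK _ T)).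
by case: d d' => [[x i]|i] [[y j]|j] //; rewrite eq_sym [odd i && _]andbC.
Qed.

Lemma arc_of_eq (d d' : D) : arc_link d d' -> arc_of d = arc_of d'.
Proof.
move=> /connect1 dd'; congr inl; apply: val_inj; apply/setP=> z /=.
by rewrite !inE (same_connect arc_connect_sym dd').
Qed.

Lemma Col_fox (c : precoloring F T) :
  c \in Col F T -> fox_labelling (fun d => c (arc_of d)).
Proof.
move/ColP=> cP; split=> [d | x | x]; last exact: cP.
  by congr (c _); apply/esym/arc_of_eq; rewrite /arc_link eqxx.
by congr (c _); apply: arc_of_eq; rewrite /arc_link /= eqxx !inordK ?orbT.
Qed.

Lemma fox_Col (C : D -> F) : fox_labelling C ->
  exists2 c, c \in Col F T & forall d, c (arc_of d) = C d.
Proof.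
move=> [Cm C13 C02].
have Ccon d d' : connect (@arc_link n T) d d' -> C d = C d'.
  case/connectP=> p; elim: p d => [|d1 p IHp] d /=; first by move=> _ ->.
  case/andP=> dd1 /IHp{}IHp /IHp <-; case/orP: dd1 => [/eqP -> | ]; first by rewrite Cm.
  have odd4 (i : 'I_4) : odd i -> i = inord 1 \/ i = inord 3.
    case: i => -[|[|[|[|]]]] // lti _; [left | right]; apply: val_inj;
      by rewrite /= inordK.
  case: d d1 {IHp} => [[x i]|i] [[y j]|j] // /and3P[/eqP <- /odd4 oi /odd4 oj].
  by case: oi oj => -> [] ->; rewrite ?(C13 x) //; apply/esym/(C13 x).
pose c : precoloring F T :=
  [ffun a => match a with inl A => C (iinv (valP A)) | inr _ => 0 end].
have cC d : c (arc_of d) = C d.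
  rewrite ffunE /=; apply: Ccon; set d1 := iinv _.
  have : arc_set d1 = arc_set d by rewrite /d1 f_iinv.
  by move/setP/(_ d); rewrite !inE connect0.
by exists c => //; apply/ColP=> x; rewrite /slot !cC; exact: C02.
Qed.

Lemma psi_ColP (u : 'rV[F]_(2 * n)) :
  reflect (exists2 C, fox_labelling C & forall i, u 0 i = C (bd i))
          (u \in psi F T @: Col F T)%VS.
Proof.
apply: (iffP memv_imgP) => [[c Cc ->] | [C /fox_Col[c Cc cC] uC]].
  by exists (fun d => c (arc_of d)); [exact: Col_fox | move=> i; rewrite lfunE mxE].
by exists c => //; rewrite lfunE; apply/rowP=> i; rewrite mxE uC cC.
Qed.

(** With checkerboard signs, a coloring becomes a flow: the signs alternate
    around each vertex, and the Fox relations make the alternating sum of the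
    colors around a crossing vanish.  Putting the signs on the face labels of
    this flow turns jumps back into sums. *)
Lemma fox_faces (C : D -> F) : fox_labelling C ->
  exists2 y, y \in faces & forall d, C d = y (rot d) + y d.
Proof.
case=> Cm C13 C02; have [b [bM bR]] := checkerboard T.
pose s d : F := (-1) ^+ b d.
have sM d : s (mate d) = - s d by rewrite /s bM; case: (b d); rewrite ?opprK.
have sR d : s (rot d) = - s d by rewrite /s bR; case: (b d); rewrite ?opprK.
have ss d : s d * s d = 1 by rewrite -expr2 sqrr_sign.
have [||z Fz dz] := @tangle_flow F n T [ffun d => s d * C d].
- apply: antisym_perp (@mateK n T) (@mate_neq n T) _ => d.
  by rewrite !ffunE sM Cm mulNr.
- move=> x; rewrite !ffunE.
  have s1 : s (cr x 1) = - s (cr x 0) by rewrite -sR rot_crossing.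
  have s2 : s (cr x 2) = s (cr x 0) by rewrite -[RHS]opprK -s1 -sR rot_crossing.
  have s3 : s (cr x 3) = - s (cr x 0) by rewrite -s2 -sR rot_crossing.
  (* The alternating sum of the colors is the Fox defect since C13 holds. *)
  rewrite s1 s2 s3 -C13.
  transitivity (s (cr x 0) * (C (cr x 0) + C (cr x 2) - 2%:R * C (cr x 1))).
    by ring.
  by rewrite C02 subrr mulr0.
exists [ffun d => - (s d * z d)].
  apply/face_labelsP => d; rewrite !ffunE sR sM opprK.
  by rewrite (face_labelsP Fz).
by move=> d; rewrite !ffunE sR mulNr opprK -mulrBr -dz ffunE mulrA ss mul1r.
Qed.

(** The hypothesis says that the jumps across both ends of the undercrossing
    strand agree. *)
Lemma faces_fox (y : {ffun D -> F^o}) : y \in faces ->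
    (forall x, y (cr x 1) - y (cr x 0) = y (cr x 3) - y (cr x 2)) ->
  fox_labelling (fun d => y (rot d) + y d).
Proof.
move=> Fy y02.
have y3 x : y (cr x 3) = y (cr x 1) - y (cr x 0) + y (cr x 2) by rewrite y02 subrK.
split=> [d | x | x]; rewrite ?rot_crossing ?y3; try by ring.
by rewrite (face_labelsP Fy) (face_labels_mate (@mateK n T) _ Fy) addrC.
Qed.

End Fox.

(** * Isotropy and coisotropy of the boundary colorings *)

Section Duality.
Variables (F : fieldType) (n : nat) (T : tangle n).

Local Notation D := (half_edge (crossing T) n).
Local Notation mate := (@mate n T).
Local Notation rot := (vertex_rot (crossing T) n).
Local Notation faces := (face_labels F mate rot).
Local Notation cr := (@at_crossing n T).
Local Notation bd := (@at_boundary n T).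

(** The sum over all half-edges of color times jump vanishes, both ends of an
    edge having the same color and opposite jumps.  At a crossing with jump j
    across either end of the undercrossing strand, the overcrossing strand
    carries total jump -2j, so that the contribution is j times the Fox defect
    of C. *)
Lemma boundary_isotropy (C : D -> F) (y : {ffun D -> F^o}) :
    fox_labelling C -> y \in faces -> fox_labelling (fun d => y (rot d) + y d) ->
  \sum_i C (bd i) * (y (bd i) - y (rot (bd i))) = 0.
Proof.
move=> [Cm C13 C02] Fy [_ y13 _].
have: \sum_d C d * (y d - y (rot d)) = 0.
  under eq_bigr do rewrite -(face_labels_mate (@mateK n T) _ Fy) mulrBr.
  rewrite sumrB (reindex_inj (inv_inj (@mateK n T))) /=.
  by apply/eqP; rewrite subr_eq0; apply/eqP/eq_bigr => d _; rewrite Cm.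
rewrite sum_half_edges big1 ?add0r // => x _; rewrite !rot_crossing.
have := y13 x; rewrite !rot_crossing => y13x.
have y3 : y (cr x 3) = y (cr x 2) + y (cr x 1) - y (cr x 0).
  by rewrite y13x addrAC subrr add0r.
rewrite -C13 y3.
transitivity ((y (cr x 0) - y (cr x 1)) *
              (C (cr x 0) + C (cr x 2) - 2%:R * C (cr x 1))).
  by ring.
by rewrite C02 subrr mulr0.
Qed.

Definition indicator (d0 : D) : {ffun D -> F^o} := [ffun d => (d == d0)%:R].

Lemma dot_indicator d0 (u : {ffun D -> F^o}) : dot (indicator d0) u = u d0.
Proof.
rewrite /dot (bigD1 d0) //= big1 => [|d /negPf d_d0];
  rewrite ffunE ?eqxx ?mul1r ?addr0 //.
by rewrite d_d0 mul0r.
Qed.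

Lemma cr_eq x y k l : (k < 4)%N -> (l < 4)%N ->
  (cr x k == cr y l) = (x == y) && (k == l).
Proof.
move=> lk ll; rewrite /at_crossing [LHS](inj_eq inl_inj) xpair_eqE.
by congr (_ && _); rewrite -(inj_eq val_inj) /= !inordK.
Qed.

(** The linear forms on half-edge labellings spanned by the relations of the
    crossings, C (x, 1) = C (x, 3) and C (x, 0) + C (x, 2) = 2 C (x, 1), are the
    functions l that vanish on the boundary and satisfy l (x, 0) = l (x, 2) and
    l (x, 0) + l (x, 1) + l (x, 2) + l (x, 3) = 0. *)
Definition relation_defect (l : {ffun D -> F^o}) : {ffun D -> F^o} :=
  [ffun d : D => match d with
   | inl (x, i) => if odd i then l (cr x 0) - l (cr x 2)
                   else l (cr x 0) + l (cr x 1) + l (cr x 2) + l (cr x 3)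
   | inr i => l (bd i)
   end].

Fact relation_defect_is_linear : linear relation_defect.
Proof.
move=> a u v; apply/ffunP=> -[[x i]|i]; rewrite !ffunE // /GRing.scale /=.
by case: ifP => _; rewrite ?ffunE /GRing.scale /=; ring.
Qed.

HB.instance Definition _ := GRing.isLinear.Build F {ffun D -> F^o}
  {ffun D -> F^o} _ relation_defect relation_defect_is_linear.

Definition crossing_relations := lker (linfun relation_defect).

Lemma crossing_relationsP (l : {ffun D -> F^o}) :
  reflect [/\ forall i, l (bd i) = 0,
              forall x, l (cr x 0) = l (cr x 2)
            & forall x, l (cr x 0) + l (cr x 1) + l (cr x 2) + l (cr x 3) = 0]
          (l \in crossing_relations).
Proof.
rewrite memv_ker lfunE /=; apply: (iffP eqP) => [l0 | [lb l02 lx]]; last first.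
  apply/ffunP=> -[[x i]|i]; rewrite !ffunE //.
  by case: ifP => _; rewrite ?lx // l02 subrr.
have {}l0 d : relation_defect l d = 0 by rewrite l0 ffunE.
split=> [i | x | x].
- by have := l0 (bd i); rewrite ffunE.
- have := l0 (cr x 1); rewrite ffunE /= inordK //= => /eqP.
  by rewrite subr_eq0 => /eqP.
by have := l0 (cr x 0); rewrite ffunE /= inordK.
Qed.

(** Each relation at a crossing is tested by the form that expresses it. *)
Lemma perp_relations_fox (C : {ffun D -> F^o}) :
    C \in invariants F (frel mate) -> C \in perp crossing_relations ->
  fox_labelling C.
Proof.
move=> /invariantsP Cm /perpP Cx; split=> [d | x | x].
- by rewrite -(Cm d) //= eqxx.
- have := Cx (indicator (cr x 1) - indicator (cr x 3)).
  have -> : dot (indicator (cr x 1) - indicator (cr x 3)) C = C (cr x 1) - C (cr x 3).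
    rewrite -!dot_indicator /dot -sumrB.
    by apply: eq_bigr => d _; rewrite !ffunE mulrBl.
  move=> C0; apply/eqP; rewrite -subr_eq0; apply/eqP/C0/crossing_relationsP.
  split=> [i | x' | x']; rewrite !ffunE ?subr0 // !cr_eq //= ?andbF ?andbT ?subr0 //.
  by case: (x' == x); rewrite /=; ring.
have := Cx (indicator (cr x 0) + indicator (cr x 2) - 2%:R *: indicator (cr x 1)).
have -> : dot (indicator (cr x 0) + indicator (cr x 2) - 2%:R *: indicator (cr x 1)) C =
    C (cr x 0) + C (cr x 2) - 2%:R * C (cr x 1).
  rewrite -!dot_indicator /dot mulr_sumr -big_split -sumrB /=.
  by apply: eq_bigr => d _; rewrite !ffunE /GRing.scale /=; ring.
move=> C0; apply/eqP; rewrite -subr_eq0; apply/eqP/C0/crossing_relationsP.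
split=> [i | x' | x']; rewrite !ffunE /GRing.scale /= ?cr_eq //= ?andbF ?andbT.
- by ring.
- by case: (x' == x); rewrite /=; ring.
- by case: (x' == x); rewrite /=; ring.
Qed.

(** Extended by zero, r kills all Fox labellings, so it is a sum t + l of a
    combination t of the edge relations and a combination l of the crossing
    relations.  Then t equals -l at the crossings, which gives both Kirchhoff's
    law and equal jumps across both ends of an undercrossing strand; and t
    equals r on the boundary. *)
Lemma boundary_coisotropy (r : 'I_(2 * n) -> F) :
    (forall C, fox_labelling C -> \sum_i C (bd i) * r i = 0) ->
  exists y : {ffun D -> F^o}, [/\ y \in faces,
    fox_labelling (fun d => y (rot d) + y d)
    & forall i, r i = y (bd i) - y (rot (bd i))].
Proof.
move=> rC; pose r' : {ffun D -> F^o} :=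
  [ffun d : D => match d return F with inr i => r i | inl _ => 0 end].
have r'_perp : r' \in perp (invariants F (frel mate) :&: perp crossing_relations).
  apply/perpP=> C; rewrite memv_cap => /andP[Cm Cx].
  rewrite -(rC C (perp_relations_fox Cm Cx)) /dot sum_half_edges big1 => [|x _].
    by rewrite add0r; apply: eq_bigr => i _; rewrite ffunE.
  by rewrite !ffunE !mulr0 !addr0.
move: r'_perp; rewrite perp_cap perpK.
case/memv_addP=> t Mt [l /crossing_relationsP[lb l02 lx] r'E].
have tE d : t d = r' d - l d by rewrite r'E ffunE addrK.
have [|y Fy dy] := tangle_flow Mt.
  move=> x; rewrite !tE !ffunE; apply: oppr_inj; rewrite oppr0 -[RHS](lx x) /=.
  by ring.
have Fz : - y \in faces by rewrite rpredN.
exists (- y); split=> // [|i].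
  apply: (@faces_fox F n T) => // x; rewrite !ffunE.
  have := dy (cr x 0); have := dy (cr x 2).
  rewrite !rot_crossing !tE !ffunE /= !sub0r -l02 => -> dE.
  apply: oppr_inj; transitivity (y (cr x 1) - y (cr x 0)); first by ring.
  by rewrite -dE; ring.
by have := dy (bd i); rewrite tE lb subr0 !ffunE /= => ->; ring.
Qed.

End Duality.

(** * The form phi in terms of corner labels *)

Lemma dim_preim (F : fieldType) (U V : vectType F) (f : 'Hom(U, V))
    (W : {vspace V}) :
  (W <= limg f)%VS -> \dim (f @^-1: W) = (\dim (lker f) + \dim W)%N.
Proof.
move=> Wf; rewrite -(limg_ker_dim f (f @^-1: W)) lpreimK //; congr (\dim _ + _)%N.
by apply/capv_idPr; rewrite -lpreim0 lpreimS ?sub0v.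
Qed.

Section BoundaryForm.
Variables (F : fieldType) (n : nat).
Hypothesis n_gt0 : (0 < n)%N.

Local Notation Y := {ffun 'I_(2 * n) -> F^o}.
Implicit Types (y : Y) (u v : 'rV[F]_(2 * n)).

Let n2_gt0 : (0 < 2 * n)%N. Proof. by rewrite muln_gt0. Qed.

Lemma sign_ord_pred (i : 'I_(2 * n)) : (-1) ^+ ord_pred i = - (-1) ^+ i :> F.
Proof.
have odd_pred : odd (ord_pred i) = ~~ odd i.
  rewrite /= odd_mod ?oddM // -[odd i](addbF _) -[false](oddM 2 n) -oddD.
  by rewrite -[in RHS](prednK (ltn_addl i n2_gt0)) /= negbK.
by rewrite -signr_odd odd_pred -[in RHS]signr_odd; case: (odd i); rewrite ?opprK.
Qed.

(** A function on 'I_(2n) is read as labels of the 2n corners of the boundary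
    vertex, corner i lying between the boundary points i and i + 1. *)
Definition corner_sums y : 'rV[F]_(2 * n) := \row_i (y (ord_pred i) + y i).

Fact corner_sums_is_linear : linear corner_sums.
Proof. by move=> a y z; apply/rowP=> i; rewrite !mxE !ffunE /GRing.scale /=; ring. Qed.

HB.instance Definition _ := GRing.isLinear.Build F Y 'rV[F]_(2 * n) _
  corner_sums corner_sums_is_linear.

Definition corner_jumps y : Y := [ffun i => y i - y (ord_pred i)].

Fact corner_jumps_is_linear : linear corner_jumps.
Proof. by move=> a y z; apply/ffunP=> i; rewrite !ffunE /GRing.scale /=; ring. Qed.

HB.instance Definition _ := GRing.isLinear.Build F Y Y _
  corner_jumps corner_jumps_is_linear.

Lemma corner_sums_Valt y : corner_sums y \in Valt F n.
Proof.
rewrite memv_ker lfunE /= /alt_sum; under eq_bigr do rewrite mxE mulrDr.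
rewrite big_split /= [X in _ + X](reindex_inj (@ord_pred_inj _)) -big_split.
apply/eqP/big1 => i _; rewrite [_ ^+ i.+1]exprS [_ ^+ (ord_pred i).+1]exprS.
by rewrite sign_ord_pred /=; ring.
Qed.

Lemma sum_at (y : Y) (j : 'I_(2 * n)) : \sum_i y i * (j == i)%:R = y j.
Proof.
rewrite (bigD1 j) //= eqxx mulr1 big1 ?addr0 // => i /negPf.
by rewrite eq_sym => ->; rewrite mulr0.
Qed.

Lemma eq_ordS (i j : 'I_(2 * n)) : (i < (2 * n).-1)%N ->
  (j == ordS i) = (j == i.+1 :> nat).
Proof.
move=> lti; rewrite -val_eqE /= [(i.+1 %% _)%N]modn_small //.
by rewrite -[X in (_ < X)%N](prednK n2_gt0).
Qed.

Let le_pred : ((2 * n).-1 <= 2 * n)%N := leq_pred _.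

(** Cyclically, corner k contributes its label times e_k + e_(k+1); this is a
    basis vector f_k for all corners but the last one. *)
Lemma corner_sums_fvec y : (forall i : 'I_(2 * n), ((2 * n).-1 <= i)%N -> y i = 0) ->
  corner_sums y = \sum_(k < (2 * n).-1) y (widen_ord le_pred k) *: fvec F n k.
Proof.
move=> y0; apply/rowP=> j; rewrite summxE mxE.
transitivity (\sum_(i < 2 * n) y i * ((j == i)%:R + (j == ordS i)%:R)).
  under eq_bigr do rewrite mulrDr.
  rewrite big_split /= sum_at addrC; congr (_ + _).
  under eq_bigr do rewrite -(can2_eq (@ord_predK _) (@ordSK _)) eq_sym.
  by under eq_bigr do rewrite eq_sym; rewrite sum_at.
rewrite (bigID (fun i : 'I__ => i < (2 * n).-1)%N) /= [X in _ + X]big1 ?addr0.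
  rewrite big_ord_narrow; apply: eq_bigr => k _; rewrite !mxE.
  by rewrite eq_ordS /=.
by move=> i; rewrite -leqNgt => /y0 ->; rewrite mul0r.
Qed.

Lemma Valt_corner_sums v : v \in Valt F n -> exists y, v = corner_sums y.
Proof.
move/(coord_basis (fbasis_basis F n_gt0)) => vE.
exists [ffun i : 'I_(2 * n) =>
  oapp (fun k => coord (fbasis F n) k v) 0 (insub (val i))].
rewrite corner_sums_fvec => [|i le_i].
  rewrite [LHS]vE; apply: eq_bigr => k _.
  by rewrite ffunE /= valK fbasis_nth.
by rewrite ffunE insubN // -leqNgt.
Qed.

(** Both sides are y (k + 1) - y (k - 1), with cyclic indices. *)
Lemma phi_corner_fvec (k : 'I_(2 * n).-1) y :
    (forall i : 'I_(2 * n), ((2 * n).-1 <= i)%N -> y i = 0) ->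
  phi (fvec F n k) (corner_sums y) = \sum_i fvec F n k 0 i * corner_jumps y i.
Proof.
move=> y0; rewrite corner_sums_fvec // phiC.
rewrite (big_morph (fun w => phi w _) (id1 := 0) (op1 := +%R)) => [|w z|].
- under eq_bigr do rewrite phiZl phi_fvec.
  set wk := widen_ord le_pred k; have lt_wk : (wk < (2 * n).-1)%N by exact: ltn_ord k.
  transitivity (y (ordS wk) - y (ord_pred wk)).
    rewrite -!sum_at -sumrB.
    rewrite [RHS](bigID (fun i : 'I__ => i < (2 * n).-1)%N) /= [X in _ + X]big1.
      rewrite big_ord_narrow addr0 -sumrN; apply: eq_bigr => l _.
      rewrite (can2_eq (@ord_predK _) (@ordSK _)) [ordS wk == _]eq_sym !eq_ordS //=.
      by rewrite /phi_basis; ring.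
    by move=> i; rewrite -leqNgt => /y0 ->; rewrite !mul0r subrr.
  under eq_bigr do rewrite mxE mulrC mulrDr.
  rewrite big_split /=.
  transitivity (corner_jumps y wk + corner_jumps y (ordS wk)).
    by rewrite !ffunE ordSK; ring.
  rewrite -!sum_at; congr (_ + _); apply: eq_bigr => i _.
    by rewrite eq_sym.
  by rewrite eq_sym eq_ordS.
- exact: phiDl.
by rewrite -[0](scale0r 0) phiZl mul0r.
Qed.

(** Adding a multiple of the alternating function to y leaves its sums unchanged
    and changes the right hand side by a multiple of the alternating sum of u,
    which is zero.  Hence the label of the last corner may be taken to be zero,
    and then the expansion of the sums in the basis f_k is known. *)
Lemma phi_corner u y : u \in Valt F n ->
  phi u (corner_sums y) = \sum_i u 0 i * corner_jumps y i.
Proof.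
move=> Vu; wlog y0 : y / forall i : 'I_(2 * n), ((2 * n).-1 <= i)%N -> y i = 0.
  move=> phi_y; pose l : 'I_(2 * n) := Ordinal (eq_leq (prednK n2_gt0)).
  pose alt : Y := [ffun i : 'I_(2 * n) => (-1) ^+ i].
  have := phi_y (y + y l *: alt).
  have -> : corner_sums (y + y l *: alt) = corner_sums y.
    apply/rowP=> i; rewrite !mxE !ffunE /GRing.scale /= sign_ord_pred; ring.
  move=> ->; last first.
    move=> i le_i.
    have -> : i = l by apply: val_inj => /=; have := ltn_ord i; lia.
    have odd_l : odd (2 * n).-1 by rewrite -[odd _]negbK -oddS prednK // oddM.
    by rewrite !ffunE /GRing.scale /= -signr_odd odd_l mulrN1 subrr.
  transitivity (\sum_i u 0 i * corner_jumps y i - 2%:R * y l * alt_sum u).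
    rewrite /alt_sum mulr_sumr -sumrB; apply: eq_bigr => i _.
    by rewrite !ffunE /GRing.scale /= sign_ord_pred exprS; ring.
  move: Vu; rewrite memv_ker lfunE /= => /eqP ->.
  by rewrite mulr0 subr0.
move/(coord_basis (fbasis_basis F n_gt0)): Vu => ->.
elim/big_ind: _ => [|v w pv pw | k _].
- rewrite -[in LHS](scale0r 0) phiZl mul0r big1 // => i _.
  by rewrite mxE mul0r.
- rewrite phiDl pv pw -big_split; apply: eq_bigr => i _.
  by rewrite [in RHS]mxE mulrDl.
rewrite phiZl fbasis_nth phi_corner_fvec // mulr_sumr.
by apply: eq_bigr => i _; rewrite [in RHS]mxE mulrA.
Qed.

Definition entries u : Y := [ffun i => u 0 i].

Fact entries_is_linear : linear entries.
Proof. by move=> a u v; apply/ffunP=> i; rewrite !ffunE !mxE. Qed.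

HB.instance Definition _ := GRing.isLinear.Build F 'rV[F]_(2 * n) Y _
  entries entries_is_linear.

Lemma lker_corner_jumps : lker (linfun corner_jumps) = <[[ffun=> 1] : Y]>%VS.
Proof.
apply/vspaceP=> y; rewrite memv_ker lfunE /=.
apply/eqP/vlineP=> [/ffunP y0 | [c ->]]; last first.
  by apply/ffunP=> i; rewrite !ffunE subrr.
have yc := ord_pred_const (f := y) _ (_ : 'I_(2 * n)) (Ordinal n2_gt0).
exists (y (Ordinal n2_gt0)); apply/ffunP=> i; rewrite !ffunE /GRing.scale /= mulr1.
apply: yc => j; have := y0 j; rewrite !ffunE => /eqP.
by rewrite subr_eq0 => /eqP.
Qed.

Lemma lker_corner_sums :
  lker (linfun corner_sums) = <[[ffun i : 'I_(2 * n) => (-1) ^+ i] : Y]>%VS.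
Proof.
apply/vspaceP=> y; rewrite memv_ker lfunE /=.
apply/eqP/vlineP=> [/rowP y0 | [c ->]]; last first.
  by apply/rowP=> i; rewrite !mxE !ffunE sign_ord_pred /GRing.scale /=; ring.
pose z (i : 'I_(2 * n)) := (-1) ^+ i * y i.
have zP i : z (ord_pred i) = z i.
  have := y0 i; rewrite !mxE => /eqP; rewrite addr_eq0 => /eqP yi.
  by rewrite /z sign_ord_pred yi mulrNN.
exists (z (Ordinal n2_gt0)); apply/ffunP=> i; rewrite !ffunE /GRing.scale /=.
by rewrite (ord_pred_const zP _ i) /z mulrAC -expr2 sqrr_sign mul1r.
Qed.

(** With S the sums and J the jumps of corner labels, phi identifies the
    preimage of W under S with the preimage under J of the standard orthogonal
    of W.  Both S and J have a kernel of dimension 1, spanned by the alternating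
    and by the constant functions, hence dim W = 2n - dim W. *)
Lemma dim_self_dual (W : {vspace 'rV[F]_(2 * n)}) :
    (W <= Valt F n)%VS -> const_mx 1 \in W -> {in W &, forall u v, phi u v = 0} ->
    (forall v, v \in Valt F n -> {in W, forall u, phi u v = 0} -> v \in W) ->
  \dim W = n.
Proof.
move=> WV W1 Wiso Wcoiso.
pose S := linfun corner_sums; pose J := linfun corner_jumps.
pose P := perp (linfun entries @: W).
have SJ : (S @^-1: W)%VS = (J @^-1: P)%VS.
  apply/vspaceP=> y; rewrite -!memv_preim !lfunE /=.
  have dotE u : dot (entries u) (corner_jumps y) = \sum_i u 0 i * corner_jumps y i.
    by apply: eq_bigr => i _; rewrite ffunE.
  apply/idP/perpP => [Wy _ /memv_imgP[u Wu ->] | Py].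
    by rewrite lfunE /= dotE -phi_corner ?Wiso // (subvP WV).
  apply: Wcoiso (corner_sums_Valt y) _ => u Wu.
  by rewrite phi_corner ?(subvP WV) // -dotE Py // -lfunE memv_img.
have one_neq0 : ([ffun=> 1] : Y) != 0.
  by apply/eqP=> /ffunP/(_ (Ordinal n2_gt0)); rewrite !ffunE => /eqP; rewrite oner_eq0.
have kerJ : \dim (lker J) = 1%N by rewrite lker_corner_jumps dim_vline one_neq0.
have kerS : \dim (lker S) = 1%N.
  rewrite lker_corner_sums dim_vline; case: eqP => // /ffunP/(_ (Ordinal n2_gt0)).
  by rewrite !ffunE => /eqP; rewrite expr0 oner_eq0.
have preS : \dim (S @^-1: W) = (1 + \dim W)%N.
  rewrite dim_preim ?kerS //; apply/subvP=> v /(subvP WV)/Valt_corner_sums[y ->].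
  by rewrite -lfunE memv_img ?memvf.
have limJ : limg J = perp <[[ffun=> 1] : Y]>%VS.
  apply/eqP; rewrite eqEdim; apply/andP; split.
    apply/subvP=> _ /memv_imgP[y _ ->]; apply/perpP=> _ /vlineP[c ->].
    rewrite lfunE /dot /=; under eq_bigr do rewrite !ffunE mulrBr.
    by rewrite sumrB [X in X - _](reindex_inj (@ord_pred_inj _)) subrr.
  have := limg_ker_dim J fullv; rewrite capfv kerJ dim_ffun => dJ.
  have := dim_perp <[[ffun=> 1] : Y]>%VS; rewrite dim_vline one_neq0 -dJ.
  by rewrite [RHS]addnC => /addIn ->.
have preJ : \dim (J @^-1: P) = (1 + \dim P)%N.
  rewrite dim_preim ?kerJ // limJ; apply/subvP=> y /perpP Py.
  apply/perpP=> _ /vlineP[c ->]; apply: Py; rewrite memvZ //.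
  have -> : [ffun=> 1] = linfun entries (const_mx 1).
    by rewrite lfunE; apply/ffunP=> i; rewrite !ffunE mxE.
  exact: memv_img.
have dimR : \dim (linfun entries @: W) = \dim W.
  apply: limg_dim_eq; apply/eqP; rewrite -subv0; apply/subvP=> u.
  rewrite memv_cap memv_ker lfunE memv0 => /andP[_ /eqP/ffunP u0].
  by apply/eqP/rowP=> i; have := u0 i; rewrite !ffunE mxE.
have := dim_perp (linfun entries @: W)%VS; rewrite dimR card_ord -/P.
have count a b m : (1 + b = 1 + a -> a + b = 2 * m -> b = m)%N by lia.
by apply: count; rewrite -preS -preJ SJ.
Qed.

End BoundaryForm.

(** * The space of boundary colorings is Lagrangian *)

Section Lagrangian.
Variables (F : fieldType) (n : nat) (T : tangle n).
Hypothesis n_gt0 : (0 < n)%N.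

Local Notation W := (psi F T @: Col F T)%VS.
Local Notation cr := (@at_crossing n T).
Local Notation bd := (@at_boundary n T).
Local Notation rot := (vertex_rot (crossing T) n).

Let n2_gt0 : (0 < 2 * n)%N. Proof. by rewrite muln_gt0. Qed.

Lemma boundary_corner_sums (u : 'rV[F]_(2 * n)) (C : half_edge (crossing T) n -> F)
    (y : {ffun half_edge (crossing T) n -> F^o}) :
    (forall i, u 0 i = C (bd i)) -> (forall d, C d = y (rot d) + y d) ->
  u = corner_sums [ffun i => y (bd i)].
Proof. by move=> uC Cy; apply/rowP=> i; rewrite uC Cy mxE !ffunE. Qed.

Lemma psi_Col_Valt : (W <= Valt F n)%VS.
Proof.
apply/subvP=> u /psi_ColP[C /fox_faces[y _ Cy] uC].
by rewrite (boundary_corner_sums uC Cy) corner_sums_Valt.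
Qed.

Lemma const_psi_Col : const_mx 1 \in W.
Proof.
apply/psi_ColP; exists (fun=> 1) => [|i]; last by rewrite mxE.
by split=> // x; ring.
Qed.

Lemma psi_Col_isotropic : {in W &, forall u v, phi u v = 0}.
Proof.
move=> u v Wu /psi_ColP[C foxC vC].
have [y Fy Cy] := fox_faces foxC.
have Vu := subvP psi_Col_Valt _ Wu.
rewrite (boundary_corner_sums vC Cy) phi_corner //.
case/psi_ColP: Wu => C' foxC' uC'.
have foxy : fox_labelling (fun d => y (rot d) + y d).
  by case: foxC => C1 C2 C3; split=> *; rewrite -!Cy.
rewrite -[RHS](boundary_isotropy foxC' Fy foxy); apply: eq_bigr => i _.
by rewrite uC' !ffunE.
Qed.

(** The corner labels of v have the same jumps as the face labels of some
    coloring, hence differ from them by a constant; so v differs from the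
    boundary of this coloring by a constant vector. *)
Lemma psi_Col_coisotropic v :
  v \in Valt F n -> {in W, forall u, phi u v = 0} -> v \in W.
Proof.
move=> Vv phi0; have [z zE] := Valt_corner_sums n_gt0 Vv.
have [C foxC | y [Fy foxy dy]] := @boundary_coisotropy F n T (corner_jumps z).
  have WC : \row_i C (bd i) \in W by apply/psi_ColP; exists C => // i; rewrite mxE.
  have := phi0 _ WC; rewrite zE phi_corner ?(subvP psi_Col_Valt) // => sum0.
  by rewrite -[RHS]sum0; apply: eq_bigr => i _; rewrite mxE.
pose i0 := Ordinal n2_gt0.
have zy i : z i - y (bd i) = z i0 - y (bd i0).
  apply: (ord_pred_const (f := fun i => z i - y (bd i))) => j.
  have := dy j; rewrite ffunE /= => /eqP; rewrite subr_eq => /eqP ->.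
  by ring.
have -> : v = \row_i (y (rot (bd i)) + y (bd i)) +
              (2%:R * (z i0 - y (bd i0))) *: const_mx 1.
  apply/rowP=> i; rewrite zE !mxE /= mulr1.
  rewrite -[z (ord_pred i)](subrK (y (bd (ord_pred i)))) -[z i](subrK (y (bd i))).
  by rewrite !zy; ring.
rewrite rpredD ?rpredZ ?const_psi_Col //; apply/psi_ColP.
by exists (fun d => y (rot d) + y d) => // i; rewrite mxE.
Qed.

Lemma psi_Col_pre_lagrangian : pre_lagrangian W.
Proof.
split=> [||W' W'V W'iso WW']; [exact: psi_Col_Valt | exact: psi_Col_isotropic |].
apply/eqP; rewrite eqEsubv WW' andbT; apply/subvP=> v W'v.
apply: psi_Col_coisotropic (subvP W'V _ W'v) _ => u Wu.
by apply: W'iso => //; apply: subvP Wu.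
Qed.

Lemma dim_psi_Col : \dim W = n.
Proof.
apply: dim_self_dual => //.
- exact: psi_Col_Valt.
- exact: const_psi_Col.
- exact: psi_Col_isotropic.
- exact: psi_Col_coisotropic.
Qed.

Lemma hat_psi_Col_rd : (hat_psi F T @: Col_rd F T)%VS = quotvs (Vtr F n) W.
Proof.
rewrite /Col_rd /quotvs -!limg_comp; apply: eq_in_limg => c _.
by rewrite !comp_lfunE !lfunE /= hat_psi_fun_piv lfunE.
Qed.

Lemma hat_psi_Col_rd_lagrangian : lagrangian (hat_psi F T @: Col_rd F T)%VS.
Proof.
rewrite hat_psi_Col_rd; split=> [|x1 x2|W' W'V W'iso WW'].
- exact/limgS/psi_Col_Valt.
- move=> /memv_imgP[u Wu ->] /memv_imgP[v Wv ->]; rewrite !lfunE /=.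
  by rewrite hat_phi_piv ?(subvP psi_Col_Valt) // psi_Col_isotropic.
apply/eqP; rewrite eqEsubv WW' andbT; apply/subvP=> x W'x.
have := W'x; case/memv_imgP: (subvP W'V _ W'x) => v Vv -> W'v.
apply/memv_img/psi_Col_coisotropic => // u Wu.
rewrite -(hat_phi_piv n_gt0) //; last exact: subvP psi_Col_Valt _ Wu.
rewrite -![piv _ _](lfunE (piv (Vtr F n))); apply: W'iso => //.
by apply: (subvP WW'); apply: memv_img.
Qed.

Lemma dim_hat_psi_Col_rd : \dim (hat_psi F T @: Col_rd F T)%VS = n.-1.
Proof.
have := limg_ker_dim (linfun (piv (Vtr F n))) W.
have -> : lker (linfun (piv (Vtr F n))) = Vtr F n.
  by apply/vspaceP=> u; rewrite memv_ker lfunE /= piv_eq0.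
have -> : (W :&: Vtr F n)%VS = Vtr F n.
  by apply/capv_idPr; rewrite -memvE const_psi_Col.
have one_neq0 : (const_mx 1 : 'rV[F]_(2 * n)) != 0.
  by apply/eqP=> /rowP/(_ (Ordinal n2_gt0))/eqP; rewrite !mxE oner_eq0.
by rewrite dim_psi_Col dim_vline one_neq0 hat_psi_Col_rd => /(congr1 predn).
Qed.

End Lagrangian.

Theorem theorem2p6 (p n : nat) (T : tangle n) (p_prime : prime p) (n_gt0 : (1 <= n)%N) :
  [/\ lagrangian (hat_psi 'F_p T @: Col_rd 'F_p T)%VS,
      \dim (hat_psi 'F_p T @: Col_rd 'F_p T)%VS = n.-1,
      pre_lagrangian (psi 'F_p T @: Col 'F_p T)%VS
    & \dim (psi 'F_p T @: Col 'F_p T)%VS = n].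
Proof.
split; [exact: hat_psi_Col_rd_lagrangian | exact: dim_hat_psi_Col_rd |
        exact: psi_Col_pre_lagrangian | exact: dim_psi_Col].
Qed.
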